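(* Let $z_1,z_2,\dots,z_n$ be points in the finite complex plane $\mathbb{C}$. Then $S_z=|S|=\sigma_z$ if and only if all the points $z_1,z_2,\dots,z_n$ lie on a straight line.
   Context: For complex numbers $z_1,\dots,z_n$ put $\widetilde z=\frac1n\sum_{i=1}^n z_i$, and define $$S_z^2=\frac1n\sum_{i=1}^n|z_i-\widetilde z|^2,\qquad S^2=\frac1n\sum_{i=1}^n(z_i-\widetilde z)^2\in\mathbb{C},\qquad \sigma_z^2=\frac{|S^2|+S_z^2}{2}.$$ Here $S_z\ge 0$ and $\sigma_z\ge 0$ are the nonnegative square roots of $S_z^2$ and $\sigma_z^2$, and $|S|=\sqrt{|S^2|}$. *)

(* Defs.v *)
From mathcomp Require Import all_boot all_order all_algebra.
From mathcomp Require Import classical_sets reals.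
From mathcomp Require Import complex.

Set Implicit Arguments.
Unset Strict Implicit.
Unset Printing Implicit Defensive.

Import Order.TTheory GRing.Theory Num.Theory.

Local Open Scope ring_scope.
Local Open Scope complex_scope.
Local Open Scope classical_set_scope.

Section Dispersion.
Context {R : realType} {n : nat}.
Implicit Type z : 'I_n -> R[i].

(* [`|w|] has type [R[i]] in the library; [modulus w] is the same number as an
   element of [R]. *)
Definition modulus (w : R[i]) : R := complex.Re `|w|.

Definition mean z : R[i] := n%:R^-1 * \sum_(i < n) z i.

Definition abs_variance z : R :=
  n%:R^-1 * \sum_(i < n) modulus (z i - mean z) ^+ 2.

Definition sq_variance z : R[i] :=
  n%:R^-1 * \sum_(i < n) (z i - mean z) ^+ 2.

Definition sigma_sq z : R := (modulus (sq_variance z) + abs_variance z) / 2%:R.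

(* [S_z], [|S|] and [sigma_z] *)
Definition abs_dev z : R := Num.sqrt (abs_variance z).
Definition sq_dev z : R := Num.sqrt (modulus (sq_variance z)).
Definition sigma_dev z : R := Num.sqrt (sigma_sq z).

End Dispersion.

Definition straight_line {R : realType} (L : set R[i]) : Prop :=
  exists a d : R[i], d != 0 /\ L = [set a + t%:C * d | t in [set: R]].

(* Main.v *)
Require Import Defs.
From mathcomp Require Import all_boot all_order all_algebra.
From mathcomp Require Import boolp classical_sets reals.
From mathcomp Require Import complex.

(** Put [w i = z i - mean z].  Since [sigma_dev z ^+ 2] is the midpoint of
    [sq_dev z ^+ 2] and [abs_dev z ^+ 2], the three dispersions agree as soon as
    the last two do, and this says that the triangle inequality
    [`|\sum_i w i ^+ 2| <= \sum_i `|w i| ^+ 2] is an equality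
    ([dispersions_eqP]).  Equality holds exactly when the squares [w i ^+ 2] all
    point in one direction [u].  A number whose square is a nonnegative multiple
    of [u] is a real multiple of a square root of [u], so equality means that
    the [w i] lie on one real line through the origin ([norm_sum_sqr_eqP]).
    Translating by the mean, which lies on every line containing the points,
    gives the theorem. *)

Import Order.TTheory GRing.Theory Num.Theory.

Local Open Scope ring_scope.
Local Open Scope complex_scope.
Local Open Scope classical_set_scope.

Lemma modulusE (R : realType) (w : R[i]) : (modulus w)%:C = `|w|.
Proof. exact/RRe_real/normr_real. Qed.

Lemma modulus_ge0 (R : realType) (w : R[i]) : 0 <= modulus w.
Proof. by rewrite -ler0c modulusE. Qed.

Lemma abs_variance_ge0 (R : realType) (n : nat) (z : 'I_n -> R[i]) :
  0 <= abs_variance z.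
Proof.
by rewrite mulr_ge0 ?invr_ge0 ?ler0n// sumr_ge0// => i _; rewrite sqr_ge0.
Qed.

Lemma abs_varianceE (R : realType) (n : nat) (z : 'I_n -> R[i]) :
  (abs_variance z)%:C = n%:R^-1 * \sum_(i < n) `|(z i - mean z) ^+ 2|.
Proof.
rewrite /abs_variance rmorphM fmorphV rmorph_nat rmorph_sum; congr (_ * _).
by apply: eq_bigr => i _; rewrite rmorphXn/= modulusE normrX.
Qed.

Lemma dispersions_eqP (R : realType) (n : nat) (n_gt0 : (0 < n)%N)
    (z : 'I_n -> R[i]) :
  (abs_dev z = sq_dev z /\ sq_dev z = sigma_dev z) <->
  `|\sum_(i < n) (z i - mean z) ^+ 2| = \sum_(i < n) `|(z i - mean z) ^+ 2|.
Proof.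
have nV0 : n%:R^-1 != 0 :> R[i] by rewrite invr_eq0 pnatr_eq0 -lt0n.
have sq_varE : (modulus (sq_variance z))%:C =
    n%:R^-1 * `|\sum_(i < n) (z i - mean z) ^+ 2|.
  by rewrite modulusE normrM ger0_norm// invr_ge0 ler0n.
split=> [[/eqP + _]|eq_sum].
  rewrite eqr_sqrt ?abs_variance_ge0 ?modulus_ge0// => /eqP eq_var.
  by apply: (mulfI nV0); rewrite -sq_varE -eq_var abs_varianceE.
have eq_var : modulus (sq_variance z) = abs_variance z.
  by apply: complexI; rewrite sq_varE abs_varianceE eq_sum.
rewrite /abs_dev /sq_dev /sigma_dev /sigma_sq eq_var; split=> //.
by rewrite -mulr2n -[X in X / _]mulr_natr mulfK ?pnatr_eq0.
Qed.

(** Equality in the triangle inequality aligns the squares [w i ^+ 2] along a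
    unit [u]; passing to square roots loses only a sign, which the real factor
    [t] absorbs.  Hence [d] can be taken to be [sqrtC u]. *)
Lemma norm_sum_sqr_eqP (R : realType) (n : nat) (w : 'I_n -> R[i]) :
  `|\sum_(i < n) w i ^+ 2| = \sum_(i < n) `|w i ^+ 2| <->
  (exists2 d : R[i], d != 0 & forall i, exists t : R, w i = t%:C * d).
Proof.
split=> [/normC_sum_eq [u /eqP u1 wE]|[d _ /choice [t wE]]].
  exists (sqrtC u) => [|i]; first by rewrite sqrtC_eq0 -normr_eq0 u1 oner_eq0.
  have : w i ^+ 2 == (`|w i| * sqrtC u) ^+ 2.
    by rewrite exprMn sqrtCK -normrX -wE.
  rewrite eqf_sqr => /orP[] /eqP wi.
    by exists (modulus (w i)); rewrite modulusE.
  by exists (- modulus (w i)); rewrite rmorphN/= modulusE mulNr.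
have sqE i : w i ^+ 2 = (t i ^+ 2)%:C * d ^+ 2 by rewrite wE exprMn rmorphXn.
have tsq_ge0 i : 0 <= (t i ^+ 2)%:C by rewrite ler0c sqr_ge0.
under eq_bigr do rewrite sqE.
under [RHS]eq_bigr do rewrite sqE normrM ger0_norm//.
by rewrite -!mulr_suml normrM ger0_norm// sumr_ge0.
Qed.

(** The mean is an affine combination of the points, so it stays on their line,
    at the average parameter. *)
Lemma mean_line (R : realType) (n : nat) (n_gt0 : (0 < n)%N)
    (a d : R[i]) (t : 'I_n -> R) :
  mean (fun i => a + (t i)%:C * d) = a + (n%:R^-1 * \sum_(i < n) t i)%:C * d.
Proof.
have n0 : n%:R != 0 :> R[i] by rewrite pnatr_eq0 -lt0n.
rewrite /mean big_split/= sumr_const card_ord -mulr_suml mulrDr.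
rewrite -[a *+ n]mulr_natl mulKf// rmorphM fmorphV rmorph_nat rmorph_sum.
by rewrite mulrA.
Qed.

Theorem theorem2p2 (R : realType) (n : nat) (n_gt0 : (0 < n)%N)
    (z : 'I_n -> complex R) :
  (abs_dev z = sq_dev z /\ sq_dev z = sigma_dev z)
  <-> (exists L : set (complex R), straight_line L /\ forall i : 'I_n, L (z i)).
Proof.
rewrite dispersions_eqP// norm_sum_sqr_eqP; split.
  move=> [d d0 wE]; exists [set mean z + t%:C * d | t in [set: R]].
  split=> [|i]; first by exists (mean z), d.
  by have [t wi] := wE i; exists t => //; rewrite -wi addrC subrK.
move=> [_ [[a [d [d0 ->]]] Lz]]; exists d => //.
have /choice [t zE] : forall i, exists t : R, z i = a + t%:C * d.
  by move=> i; have [t _ <-] := Lz i; exists t.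
have -> : z = fun i => a + (t i)%:C * d by apply/funext.
move=> i; exists (t i - n%:R^-1 * \sum_(j < n) t j).
by rewrite mean_line// rmorphB/= mulrBl opprD addrACA subrr add0r.
Qed.
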